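(* Define, for $n\ge 0$, $E_{2n+1}(p,q)=\sum_{\sigma\in\mathfrak{A}_{2n+1}}p^{(2\text{-}13)\sigma}q^{(31\text{-}2)\sigma}$ and $E_{2n}(p,q)=\sum_{\sigma\in\mathfrak{A}_{2n}}p^{(2\text{-}31)\sigma}q^{(31\text{-}2)\sigma}$ (with $E_0(p,q)=1$). Then, as formal power series in $t$, $$\sum_{n=0}^{\infty} E_{2n+1}(p,q) t^{2n+1} =\cfrac{t}{1-\cfrac{[1]_{p,q}[2]_{p,q}t^2}{1-\cfrac{[2]_{p,q}[3]_{p,q}t^2}{1-\cfrac{[3]_{p,q}[4]_{p,q}t^2}{\ddots}}}}, \qquad \sum_{n=0}^{\infty} E_{2n}(p,q) t^{2n} =\cfrac{1}{1-\cfrac{[1]_{p,q}^2t^2}{1-\cfrac{[2]_{p,q}^2t^2}{1-\cfrac{[3]_{p,q}^2t^2}{\ddots}}}},$$ where $[n]_{p,q}=(p^n-q^n)/(p-q)=\sum_{i=0}^{n-1}p^iq^{n-1-i}$.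
   Context: $\mathfrak{A}_m$ is the set of falling alternating permutations $\sigma=\sigma_1\cdots\sigma_m$ of $\{1,\dots,m\}$, i.e. $\sigma_1>\sigma_2<\sigma_3>\sigma_4<\cdots$. For such $\sigma$: $(31\text{-}2)\sigma=\#\{(i,j): i+1<j,\ \sigma_i>\sigma_j>\sigma_{i+1}\}$; $(2\text{-}31)\sigma=\#\{(i,j): j<i-1,\ \sigma_{i-1}>\sigma_j>\sigma_i\}$; $(2\text{-}13)\sigma=\#\{(i,j): j<i-1,\ \sigma_{i-1}<\sigma_j<\sigma_i\}$. *)

(* Defs.v *)
From mathcomp Require Import all_boot all_order all_algebra all_fingroup.
Set Implicit Arguments. Unset Strict Implicit. Unset Printing Implicit Defensive.
Import GRing.Theory.
Local Open Scope ring_scope.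

(* A permutation s : 'S_m of {0,..,m-1} is read as the word
   sigma_1 ... sigma_m with sigma_{i+1} = s i + 1 (0-indexed positions and
   values; all statistics only depend on relative order). *)
Definition pword (m : nat) (s : 'S_m) : seq nat := [seq val (s i) | i <- enum 'I_m].
Definition pw (m : nat) (s : 'S_m) (i : nat) : nat := nth 0%N (pword s) i.

Definition falt (m : nat) (s : 'S_m) : bool :=
  [forall i : 'I_m, (i.+1 < m)%N ==>
     (if odd i then (pw s i < pw s i.+1)%N else (pw s i.+1 < pw s i)%N)].

Definition st31_2 (m : nat) (s : 'S_m) : nat :=
  (\sum_(i < m) \sum_(j < m)
     [&& (i.+1 < j)%N, (pw s j < pw s i)%N & (pw s i.+1 < pw s j)%N])%N.

(* (2-31): pairs (i,j), j<i-1, sigma_{i-1} > sigma_j > sigma_i ;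
   here k = i-1 (0-indexed), so positions k, k+1 and j < k *)
Definition st2_31 (m : nat) (s : 'S_m) : nat :=
  (\sum_(k < m) \sum_(j < m)
     [&& (j < k)%N, (k.+1 < m)%N, (pw s j < pw s k)%N & (pw s k.+1 < pw s j)%N])%N.

Definition st2_13 (m : nat) (s : 'S_m) : nat :=
  (\sum_(k < m) \sum_(j < m)
     [&& (j < k)%N, (k.+1 < m)%N, (pw s k < pw s j)%N & (pw s j < pw s k.+1)%N])%N.

Definition Eodd (R : comRingType) (p q : R) (n : nat) : R :=
  \sum_(s : 'S_(n.*2.+1) | falt s) p ^+ st2_13 s * q ^+ st31_2 s.
Definition Eeven (R : comRingType) (p q : R) (n : nat) : R :=
  \sum_(s : 'S_(n.*2) | falt s) p ^+ st2_31 s * q ^+ st31_2 s.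

Definition pqint (R : comRingType) (p q : R) (n : nat) : R :=
  \sum_(i < n) p ^+ i * q ^+ (n.-1 - i).

Definition fps (R : comRingType) := nat -> R.

Definition fps1 (R : comRingType) : fps R := fun n => (n == 0%N)%:R.

Definition fps_t2 (R : comRingType) (f : fps R) : fps R :=
  fun n => if (n < 2)%N then 0 else f (n - 2)%N.

(* first N+1 coefficients of 1/(1 - h), for h with h 0 = 0:
   g_0 = 1, g_N = sum_{k=1}^N h_k g_{N-k} *)
Fixpoint inv1m_seq (R : comRingType) (h : fps R) (N : nat) : seq R :=
  match N with
  | 0 => [:: 1]
  | N'.+1 => let s := inv1m_seq h N' in
             rcons s (\sum_(k < N'.+1) h k.+1 * nth 0 s (N' - k))
  end.

(* the power series 1/(1 - h) (h is assumed to have zero constant term) *)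
Definition inv1m (R : comRingType) (h : fps R) : fps R :=
  fun n => nth 0 (inv1m_seq h n) n.

(* depth-m truncation of the continued fraction
   1/(1 - a_0 t^2/(1 - a_1 t^2/( ... /(1 - a_{m-1} t^2)))) ;
   depth 0 is the constant series 1. *)
Fixpoint cfrac (R : comRingType) (a : nat -> R) (m : nat) : fps R :=
  match m with
  | 0 => fps1 R
  | m'.+1 => inv1m (fun n => a 0%N * fps_t2 (cfrac (fun i => a i.+1) m') n)
  end.

(* Main.v *)
Require Import Defs.
From mathcomp Require Import all_boot all_order all_algebra all_fingroup.
From mathcomp Require Import ring zify.
Set Implicit Arguments. Unset Strict Implicit. Unset Printing Implicit Defensive.
Import GRing.Theory.
Local Open Scope ring_scope.

(* Build a falling alternating permutation by placing the values 0, 1, 2, ...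
   in increasing order, writing a placeholder N (larger than every value) for
   each gap that larger values remain to fill.
   The next value either replaces one of the H placeholders (a new peak) or
   turns one of them into N k N (a new valley).  Only the placeholders
   contribute to the patterns in which k plays the 2: choosing the i-th of the
   H placeholders contributes q^i p^(H-1-i), so each move carries a total
   weight [H].  Words of even length get one more, final, placeholder, which is
   never replaced; this turns the weight of a new peak into [H-1].  The sums
   over permutations are thus weighted counts of Dyck paths, and the continued
   fraction is the solution of the recursion satisfied by these counts. *)

(** * Weighted paths and continued fractions *)
Section ContinuedFraction.
Variable R : comRingType.

Lemma size_inv1m_seq (h : fps R) n : size (inv1m_seq h n) = n.+1.
Proof. by elim: n => //= n IHn; rewrite size_rcons IHn. Qed.

Lemma nth_inv1m_seq (h : fps R) n i :
  (i <= n)%N -> nth 0 (inv1m_seq h n) i = inv1m h i.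
Proof.
elim: n => [|n IHn]; first by rewrite leqn0 => /eqP->.
rewrite leq_eqVlt => /predU1P[-> //|lt_in].
by rewrite /= nth_rcons size_inv1m_seq lt_in IHn.
Qed.

Lemma inv1mS (h : fps R) n :
  inv1m h n.+1 = \sum_(k < n.+1) h k.+1 * inv1m h (n - k)%N.
Proof.
rewrite {1}/inv1m /= nth_rcons size_inv1m_seq ltnn eqxx.
by apply: eq_bigr => k _; rewrite nth_inv1m_seq ?leq_subr.
Qed.

(** The fixed-point equation g = 1 + h g, read coefficientwise in a form that includes degree 0 and
    has the shape of a polynomial product. *)
Lemma inv1mE (h : fps R) n : h 0%N = 0 ->
  inv1m h n = (n == 0%N)%:R + \sum_(k < n.+1) h k * inv1m h (n - k)%N.
Proof.
move=> h0; case: n => [|n]; first by rewrite big_ord1 h0 mul0r addr0.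
by rewrite add0r inv1mS [RHS]big_ord_recl h0 mul0r add0r.
Qed.

Variables u d : nat -> R.

(* Weighted count of the nonnegative +1/-1 paths of length k from height 0 to
   height h: u h weighs the up-step arriving at h, d h the down-step arriving
   at h.  The junk case h = 0 of the second term is harmless once u 0 = 0. *)
Fixpoint wpath (k h : nat) : R :=
  if k is k'.+1 then d h * wpath k' h.+1 + u h * wpath k' h.-1
  else (h == 0%N)%:R.

Lemma wpath_lt k h : (k < h)%N -> wpath k h = 0.
Proof.
elim: k h => [|k IHk] [|h] //= lt_kh.
by rewrite !IHk ?mulr0 ?addr0 //; lia.
Qed.

Hypothesis u0 : u 0%N = 0.

Lemma wpath_parity k h : odd (k + h) -> wpath k h = 0.
Proof.
elim: k h => [|k IHk] h /=; first by case: h.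
move=> odd_kh; rewrite IHk ?addnS // mulr0 add0r.
case: h odd_kh => [|h] odd_kh; first by rewrite u0 mul0r.
by rewrite IHk ?mulr0 //; move: odd_kh; rewrite addnS /= negbK.
Qed.

Let a h := u h.+1 * d h.
Variable m : nat.

(* The tail of the continued fraction that starts at level [h]. *)
Let c h : {poly R} :=
  \poly_(i < m.+1) cfrac (iter h (fun f j => f j.+1) a) (m - h) i.

(** Unfolding one level of the fraction gives c_h = 1 + a_h t^2 c_(h+1) c_h exactly as power series.
    The truncated polynomials satisfy it modulo X^(m+1), and [e] absorbs the terms of higher
    degree. *)
Let tail_eq h : (h < m)%N ->
  exists e, c h = 1 + (a h)%:P * 'X^2 * c h.+1 * c h + e * 'X^(m.+1).
Proof.
move=> lt_hm; set rhs := 1 + (a h)%:P * 'X^2 * c h.+1 * c h.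
exists (- drop_poly m.+1 rhs).
rewrite -[rhs in rhs + _](poly_take_drop m.+1) mulNr addrK.
apply/polyP=> i; rewrite coef_poly coef_take_poly.
case: ltnP => // le_im.
have Dm : (m - h = (m - h.+1).+1)%N by lia.
have iterE j : iter h (fun f j => f j.+1) a j = a (h + j)%N.
  by elim: (h) j => //= h' IHh j; rewrite IHh addnS.
rewrite {1}Dm /= inv1mE ?mulr0 // iterE addn0 /rhs coefD coef1; congr (_ + _).
rewrite -mulrA -mulrA [_ * (_ * c h)]mulrA coefCM coefM mulr_sumr; apply: eq_bigr => j _.
rewrite mulrA; congr (_ * _ * _).
- rewrite coefXnM /fps_t2; case: ifP => // _; rewrite coef_poly ifT //.
  by have := ltn_ord j; lia.
- rewrite coef_poly ifT; last by have := ltn_ord j; lia.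
  by rewrite Dm /= iterE addn0.
Qed.

(* Up to degree [m], the generating function of the paths ending at height [h],
   split at their last visits to the heights 0, ..., h-1. *)
Let g h : {poly R} := \prod_(j < h) ((u j.+1)%:P * c j) * 'X^h * c h.

(** Modulo X^(m+1), [tail_eq] turns into g_h = [h = 0] + X (d_h g_(h+1) + u_h g_(h-1)), which is the
    recursion of [wpath] on the last step. *)
Let coef_g k h : (k <= m)%N -> (h <= m)%N -> (g h)`_k = wpath k h.
Proof.
have gS j : g j.+1 = (u j.+1)%:P * 'X * g j * c j.+1.
  by rewrite /g big_ord_recr /= exprS; ring.
elim: k h => [|k IHk] h lt_km le_hm /=.
  case: h le_hm => [|h] _; last by rewrite gS -!mulrA coefCM coefXM mulr0.
  by rewrite /g big_ord0 !mul1r coef_poly /= subn0; case: (m).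
have coefS e (f : {poly R}) : (f + e * 'X^(m.+1))`_k.+1 = f`_k.+1.
  by rewrite coefD coefMXn ltnS lt_km addr0.
case: h le_hm => [|h] le_hm.
  have [e De] := tail_eq (leq_ltn_trans (leq0n k) lt_km).
  have -> : g 0 = 1 + (d 0)%:P * ('X * g 1) + e * 'X^(m.+1).
    rewrite gS /g big_ord0 expr0 !mul1r {1}De /a polyCM; ring.
  rewrite coefS coefD coef1 add0r coefCM coefXM /= IHk; try lia.
  by rewrite u0 mul0r addr0.
case: (ltnP h.+1 m) => [lt_hm | le_mh].
  have [e De] := tail_eq lt_hm.
  have -> : g h.+1 = (d h.+1)%:P * ('X * g h.+2) + (u h.+1)%:P * ('X * g h)
     + ((u h.+1)%:P * 'X * g h * e) * 'X^(m.+1).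
    rewrite !gS {1}De /a polyCM; ring.
  by rewrite coefS coefD !coefCM !coefXM /= !IHk //; lia.
(* At the top height m the remaining fraction has depth 0, so its series is 1. The missing down-step
   would start at height m+1, which fewer than m steps cannot reach. *)
have Dm : m = h.+1 by lia.
have c1 : c h.+1 = 1.
  apply/polyP=> i; rewrite coef_poly Dm subnn coef1 /= /fps1.
  by case: ltnP => //; case: i.
rewrite gS c1 mulr1 -mulrA coefCM coefXM /= IHk; try lia.
by rewrite (@wpath_lt k h.+2) ?mulr0 ?add0r //; lia.
Qed.

(** Flajolet's correspondence: depth m limits the height of the paths to m, which is no restriction
    on paths of length at most m. *)
Lemma cfrac_wpath k : (k <= m)%N -> cfrac a m k = wpath k 0.
Proof.
move=> le_km; rewrite -coef_g // /g big_ord0 mul1r mul1r coef_poly.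
by rewrite ltnS le_km subn0.
Qed.

End ContinuedFraction.

(** * Straddled descents and ascents *)
Local Open Scope nat_scope.

Fixpoint adj (r : rel nat) (s : seq nat) : nat :=
  if s is a :: s' then (if s' is b :: _ then r a b : nat else 0) + adj r s'
  else 0.

Definition straddle (down : bool) (x : nat) : rel nat :=
  fun a b => if down then b < x < a else a < x < b.

(* 31-2 patterns whose 2 lies in [s], in the word [u ++ s]. *)
Fixpoint lstat (u s : seq nat) : nat :=
  if s is a :: s' then adj (straddle true a) u + lstat (rcons u a) s' else 0.

(* 2-31 (resp. 2-13) patterns whose 2 lies in [s], in the word [s ++ u]. *)
Fixpoint rstat (down : bool) (s u : seq nat) : nat :=
  if s is a :: s' then adj (straddle down a) (s' ++ u) + rstat down s' u else 0.

Fixpoint alternating (up : bool) (s : seq nat) : bool :=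
  if s is a :: s' then
    (if s' is b :: _ then (if up then a < b else b < a) else true)
      && alternating (~~ up) s'
  else true.

Section Statistics.
Variable down : bool.

Lemma lstat_cat u s1 s2 : lstat u (s1 ++ s2) = lstat u s1 + lstat (u ++ s1) s2.
Proof.
elim: s1 u => [|a s1 IH] u /=; first by rewrite cats0.
by rewrite IH addnA -cats1 -catA.
Qed.

Lemma rstat_cat s1 s2 u :
  rstat down (s1 ++ s2) u = rstat down s1 (s2 ++ u) + rstat down s2 u.
Proof. by elim: s1 => //= a s1 ->; rewrite addnA catA. Qed.

(** Straddling [x] only depends on which entries lie above [x], so a nonempty run of larger entries
    acts as one larger entry. *)
Lemma adj_straddle_swap x y r s1 s2 : x < y -> all (ltn x) r -> r != [::] ->
  adj (straddle down x) (s1 ++ r ++ s2) = adj (straddle down x) (s1 ++ y :: s2).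
Proof.
move=> xy; case: r => //= z r /andP[xz xr] _.
have adj_head a b s : x < a -> x < b ->
    adj (straddle down x) (a :: s) = adj (straddle down x) (b :: s).
  move=> xa xb; case: s => //= c s; congr (_ + _).
  by rewrite /straddle; case: down; lia.
have Er : adj (straddle down x) (z :: r ++ s2) = adj (straddle down x) (y :: s2).
  elim: r z xz xr => [|c r IH] z xz; first by move=> _; apply: adj_head.
  case/andP=> xc xr; rewrite -[RHS](IH c xc xr) /= /straddle.
  by move: xc => /=; case: down; lia.
elim: s1 => //= a s1 ->; congr (_ + _).
case: s1 => //=; rewrite /straddle; case: down; lia.
Qed.

Lemma adj_straddle_max x s : all (geq x) s -> adj (straddle down x) s = 0.
Proof.
elim: s => //= a s IH /andP[ax xs]; rewrite IH // addn0.
case: s xs {IH} => //= b s /andP[bx _].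
by rewrite /straddle; case: down; lia.
Qed.

End Statistics.

Lemma adj_desc_rcons x y s : x <= y ->
  adj (straddle true x) (rcons s y) = adj (straddle true x) s.
Proof.
move=> xy; elim: s => //= a s ->; congr (_ + _).
by case: s => //=; rewrite /straddle; lia.
Qed.

(** * Effect of one insertion on the statistics *)

Section Insertion.
(* [N] stands for a peak whose value is not decided yet. *)
Variables (N k : nat).
Hypothesis kN : k < N.

Definition partial (x : nat) := (x < k) || (x == N).

Lemma partial_le s : all partial s -> all (geq N) s.
Proof. by apply: sub_all => x /orP[|/eqP->] /=; lia. Qed.

Lemma straddleNN down u : all partial u -> adj (straddle down N) u = 0.
Proof. by move/partial_le; apply: adj_straddle_max. Qed.

Definition noNN : rel nat := fun a b => ~~ ((a == N) && (b == N)).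

(** Only placeholders exceed [k], and none is followed by another one. Hence each placeholder starts
    a descent straddling [k], unless it is the last entry. *)
Lemma adj_desc a s : all partial (a :: s) -> path noNN a s ->
  adj (straddle true k) (a :: s) = count_mem N (belast a s).
Proof.
elim: s a => //= b s IH a /andP[pa pbs] /andP[nn pth].
rewrite -IH //= /straddle; congr (_ + _).
by case/andP: pbs => pb _; move: pa pb nn; rewrite /partial /noNN; lia.
Qed.

(** Symmetrically, each placeholder ends a straddling ascent, unless it is the first entry. *)
Lemma adj_asc a s : all partial (a :: s) -> path noNN a s ->
  adj (straddle false k) (a :: s) = count_mem N s.
Proof.
elim: s a => //= b s IH a /andP[pa pbs] /andP[nn pth].
rewrite -(IH b) //= /straddle; congr (_ + _).
by case/andP: pbs => pb _; move: pa pb nn; rewrite /partial /noNN; lia.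
Qed.

Definition block (r : seq nat) := (r == [:: k]) || (r == [:: N; k; N]).

(** A value below [k] sees the block as a single larger entry, and nothing straddles [N]. So a move
    preserves the patterns whose 2 is an older entry. *)
Lemma adj_block down x r s1 s2 : block r -> all partial (x :: s1 ++ s2) ->
  adj (straddle down x) (s1 ++ r ++ s2) = adj (straddle down x) (s1 ++ N :: s2).
Proof.
move=> br /= /andP[/orP[xk|/eqP->] ps].
  by apply: adj_straddle_swap; [lia | case/orP: br => /eqP-> /=; lia |
    case/orP: br => /eqP->].
have le_s: all (geq N) (s1 ++ N :: s2).
  by move/partial_le: ps; rewrite !all_cat /= leqnn.
rewrite !adj_straddle_max //; move: le_s; rewrite !all_cat /=.
by case/and3P=> -> _ ->; case/orP: br => /eqP-> /=; rewrite ?leqnn (ltnW kN).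
Qed.

Lemma lstat_block u r v s : block r -> all partial (u ++ v ++ s) ->
  lstat (u ++ r ++ v) s = lstat (u ++ N :: v) s.
Proof.
move=> br; elim: s v => //= a s IH v.
rewrite !all_cat /= => /and4P[pu pv pa ps].
rewrite adj_block //= ?all_cat ?pa ?pu //; congr (_ + _).
by rewrite !rcons_cat rcons_cons IH // !all_cat all_rcons pu pa pv.
Qed.

Lemma rstat_block down s r t : block r -> all partial (s ++ t) ->
  rstat down s (r ++ t) = rstat down s (N :: t).
Proof. by move=> br; elim: s => //= a s IH /andP[pa ps]; rewrite adj_block ?IH //= pa. Qed.

Variables s1 s2 : seq nat.
Hypothesis partial_s : all partial (s1 ++ N :: s2).
Hypothesis noNN_s : sorted noNN (s1 ++ N :: s2).

Let partial1 : all partial s1.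
Proof. by move: partial_s; rewrite all_cat => /andP[]. Qed.

Let partial2 : all partial s2.
Proof. by move: partial_s; rewrite all_cat /= => /and3P[]. Qed.

Let partial12 : all partial (s1 ++ s2).
Proof. by rewrite all_cat partial1. Qed.

Let partial_N : partial N.
Proof. by rewrite /partial eqxx orbT. Qed.

Let sorted1 : sorted noNN (rcons s1 N).
Proof.
by move: noNN_s; rewrite -cat_rcons; case: (s1) => //= a s; rewrite cat_path => /andP[].
Qed.

Let sorted2 : path noNN N s2.
Proof.
move: noNN_s; case: (s1) => //= a s; rewrite cat_path => /andP[_] /=.
by case/andP.
Qed.

Lemma adj_desc_left : adj (straddle true k) (rcons s1 N) = count_mem N s1.
Proof.
move: sorted1 partial1; case: (s1) => // a s pth ps.
by rewrite rcons_cons adj_desc //= ?belast_rcons //= all_rcons partial_N andbCA.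
Qed.

(** The new patterns are those in which [k] is the 2. Each placeholder of [s1] starts one descent
    straddling [k], since it is followed by a smaller entry. *)
Lemma lstat_insert r : block r ->
  lstat [::] (s1 ++ r ++ s2) = lstat [::] (s1 ++ N :: s2) + count_mem N s1.
Proof.
move=> br; rewrite !lstat_cat /= straddleNN //.
have := @lstat_block s1 r [::] s2 br; rewrite cats0 cats1 => -> //.
have -> : lstat s1 r = count_mem N s1; last by rewrite add0n addnA addnAC.
case/orP: br => /eqP->/=.
  by rewrite addn0 -adj_desc_left adj_desc_rcons // ltnW.
rewrite adj_desc_left straddleNN // addn0 add0n.
by rewrite adj_straddle_max ?addn0 // !all_rcons /= leqnn (ltnW kN) partial_le.
Qed.

Lemma adj_asc_right : adj (straddle false k) (N :: s2) = count_mem N s2.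
Proof. by rewrite adj_asc //= partial_N. Qed.

Lemma rstat_block2 down t : all partial t ->
  rstat down [:: N; k; N] t = adj (straddle down k) (N :: t).
Proof.
move=> pt; rewrite /rstat !cat_cons cat0s addn0 (straddleNN _ pt) addn0.
by rewrite adj_straddle_max //= leqnn (ltnW kN) partial_le.
Qed.

Lemma rstat_insert down r : block r ->
  rstat down (s1 ++ r ++ s2) [::]
    = rstat down (s1 ++ N :: s2) [::] + rstat down r s2.
Proof.
move=> br; rewrite !rstat_cat !cats0 rstat_block //= cats0 straddleNN //.
by rewrite add0n addnA addnAC.
Qed.

Lemma rstat_asc_insert r : block r ->
  rstat false (s1 ++ r ++ s2) [::]
    = rstat false (s1 ++ N :: s2) [::] + count_mem N s2.
Proof.
move=> br; rewrite rstat_insert //; congr (_ + _).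
case/orP: br => /eqP->; last by rewrite rstat_block2 ?adj_asc_right.
rewrite -adj_asc_right /= addn0; case: (s2) => //= a s.
by rewrite /straddle (leq_gtF (ltnW kN)).
Qed.

(** The final placeholder is followed by nothing and starts no descent, hence the predecessor. *)
Lemma rstat_desc_insert_peak : s2 != [::] -> last N s2 = N ->
  rstat true (s1 ++ k :: s2) [::]
    = rstat true (s1 ++ N :: s2) [::] + (count_mem N s2).-1.
Proof.
move=> s2n lastN; rewrite -[k :: s2]cat1s rstat_insert ?/block ?eqxx //.
congr (_ + _); rewrite /= addn0.
move: s2n lastN sorted2 partial2; case: (s2) => // a s _ lastN /andP[_ pth] pas.
rewrite adj_desc //; have := lastI a s; rewrite [last a s]lastN => /(congr1 (count_mem N)).
by rewrite -cats1 count_cat /= eqxx !addn0 => ->; rewrite addn1.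
Qed.

(** Here the placeholder just right of [k] makes up for the final one. The default [N] of [last]
    covers the case where the final placeholder itself is split. *)
Lemma rstat_desc_insert_valley : last N s2 = N ->
  rstat true (s1 ++ [:: N, k, N & s2]) [::]
    = rstat true (s1 ++ N :: s2) [::] + count_mem N s2.
Proof.
move=> lastN; rewrite (@rstat_insert true [:: N; k; N]) ?/block ?eqxx ?orbT //.
congr (_ + _); rewrite rstat_block2 // adj_desc //= ?partial_N //.
have := lastI N s2; rewrite lastN => /(congr1 (count_mem N)).
by rewrite -cats1 count_cat /= eqxx !addn0 addnC => /addIn.
Qed.

End Insertion.

(** * Partially filled words *)

Lemma alternating_noNN N b s : alternating b s -> sorted (noNN N) s.
Proof.
elim: s b => //= a [|c s] IH b //= /andP[ac /IH /= ->]; rewrite andbT /noNN.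
by case: b ac; lia.
Qed.

Section Words.
Variable N : nat.

Definition occ (w : seq nat) := [seq i <- iota 0 (size w) | nth 0 w i == N].

Lemma occ_cons x w :
  occ (x :: w) = nseq (x == N) 0 ++ [seq i.+1 | i <- occ w].
Proof.
rewrite /occ /= -[1]addn0 iotaDl filter_map /=.
by case: (x == N).
Qed.

Definition rep (r : seq nat) (w : seq nat) (i : nat) := take i w ++ r ++ drop i.+1 w.

Definition step k w := map (rep [:: k] w) (occ w) ++ map (rep [:: N; k; N] w) (occ w).

Fixpoint words k :=
  if k is k'.+1 then flatten [seq step k' w | w <- words k'] else [:: [:: N]].

(** An intrinsic description of the states generated by [words]. Odd length makes both end positions
    peak positions. *)
Definition word k w :=
  [&& odd (size w), alternating false w, all (partial N k) w
    & all (fun x => count_mem x w == 1) (iota 0 k)].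

Lemma occP w i : reflect (exists s1 s2, w = s1 ++ N :: s2 /\ i = size s1) (i \in occ w).
Proof.
rewrite mem_filter mem_iota /= add0n.
apply: (iffP andP) => [[/eqP wi lt_iw] | [s1 [s2 [-> ->]]]].
  exists (take i w), (drop i.+1 w); rewrite -wi -drop_nth // cat_take_drop.
  by rewrite size_take lt_iw.
by rewrite nth_cat ltnn subnn size_cat /= eqxx; split=> //; lia.
Qed.

Lemma rep_cat r s1 s2 : rep r (s1 ++ N :: s2) (size s1) = s1 ++ r ++ s2.
Proof. by rewrite /rep take_size_cat // drop_cat ltnNge leqnSn /= subSnn /= drop0. Qed.

Lemma stepP k w w' :
  reflect (exists s1 s2 r, [/\ w = s1 ++ N :: s2, block N k r & w' = s1 ++ r ++ s2])
          (w' \in step k w).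
Proof.
rewrite mem_cat; apply: (iffP orP) => [[] /mapP[i /occP[s1 [s2 [-> ->]]]] -> |].
- by exists s1, s2, [:: k]; rewrite rep_cat /block eqxx.
- by exists s1, s2, [:: N; k; N]; rewrite rep_cat /block eqxx orbT.
case=> s1 [s2 [r [-> /orP[]/eqP-> ->]]]; [left | right]; rewrite -rep_cat map_f //;
  by apply/occP; exists s1, s2.
Qed.

(** * Each move is reversible *)

Section Step.
Variable k : nat.
Hypothesis kN : k < N.

(** The parity of the length ensures that a valley position always has a right neighbour, which
    would have to exceed the maximum [N]. The parameter [b] is there for the induction. *)
Lemma even_position b s1 s2 : all (geq N) (s1 ++ N :: s2) ->
  odd (size (s1 ++ N :: s2)) = ~~ b ->
  alternating b (s1 ++ N :: s2) -> b (+) odd (size s1) = false.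
Proof.
elim: s1 b => [|a s1 IH] b; last first.
  move=> /= /andP[_ le1] odd1 /andP[_ alt1].
  have e : odd (size (s1 ++ N :: s2)) = ~~ ~~ b by rewrite -odd1 negbK.
  by have := IH _ le1 e alt1; case: (b); case: (odd _).
case: b => //=; case: s2 => //= a s2 /andP[_ /andP[aN _]] _ /andP[lt_Na _].
lia.
Qed.

(** The neighbours of a peak [N] are smaller than [N], so they are placed values, all below [k]. *)
Lemma alternating_lower b s1 s2 : all (partial N k) (s1 ++ s2) ->
  b (+) odd (size s1) = false ->
  alternating b (s1 ++ N :: s2) -> alternating b (s1 ++ k :: s2).
Proof.
elim: s1 b => [|a s1 IH] b.
  by rewrite addbF /= => + ->; case: s2 => //= a s2 /andP[+ _]; rewrite /partial; lia.
move=> /= /andP[pa p1] odd1 /andP[a1 alt1]; apply/andP; split.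
  case: s1 a1 odd1 {IH p1 alt1} => //= aN; rewrite addbT => /negbFE->.
  by move: aN pa; rewrite /partial; case: b; lia.
by apply: IH => //; move: odd1; case: b {a1 alt1}; case: (odd _).
Qed.

Lemma alternating_raise b s1 s2 : b (+) odd (size s1) = false ->
  alternating b (s1 ++ k :: s2) -> alternating b (s1 ++ N :: s2).
Proof.
elim: s1 b => [|a s1 IH] b.
  by rewrite addbF /= => ->; case: s2 => //= a s2 /andP[ak ->]; rewrite (ltn_trans ak).
move=> /= odd1 /andP[a1 alt1]; apply/andP; split.
  case: s1 a1 odd1 {IH alt1} => //= + /[!addbT] /negbFE eb; rewrite eb.
  by lia.
by apply: IH => //; move: odd1; case: b {a1 alt1}; case: (odd _).
Qed.

Lemma alternating_dip b s1 x y z s2 : b (+) odd (size s1) = false ->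
  alternating b (s1 ++ [:: x, y, z & s2]) -> y < x /\ y < z.
Proof.
elim: s1 b => [|a s1 IH] b /=; first by rewrite addbF => -> /and3P[].
move=> odd1 /andP[_]; apply: IH.
by move: odd1; case: b; case: (odd _).
Qed.

Lemma alternating_valley b s1 s2 : b (+) odd (size s1) = false ->
  alternating b (s1 ++ [:: N, k, N & s2]) = alternating b (s1 ++ N :: s2).
Proof.
elim: s1 b => [|a s1 IH] b; first by rewrite addbF /= => ->; rewrite kN.
move=> /= odd1; rewrite IH; first by case: s1 {IH odd1}.
by move: odd1; case: b; case: (odd _).
Qed.

Lemma word_step w w' : word k w -> w' \in step k w -> word k.+1 w'.
Proof.
move=> /and4P[odd_w alt_w part_w cnt_w] /stepP[s1 [s2 [r [Dw br ->]]]].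
rewrite {w}Dw in odd_w alt_w part_w cnt_w.
have ev: odd (size s1) = false.
  by apply: even_position alt_w => //; apply: partial_le part_w.
have [p1 p2]: all (partial N k) s1 /\ all (partial N k) s2.
  by move: part_w; rewrite all_cat /= => /and3P[].
have p12: all (partial N k) (s1 ++ s2) by rewrite all_cat p1.
have pS s : all (partial N k) s -> all (partial N k.+1) s.
  by apply: sub_all => x; rewrite /partial; lia.
have k_s s : all (partial N k) s -> count_mem k s = 0.
  move=> ps; apply/count_memPn/negP=> /(allP ps); rewrite /partial; lia.
apply/and4P; split.
- by move: odd_w; rewrite !size_cat /= !oddD; case/orP: br => /eqP->.
- case/orP: br => /eqP-> /=; first exact: alternating_lower alt_w.
  by rewrite alternating_valley.
- rewrite !all_cat (pS _ p1) (pS _ p2) andbT.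
  by case/orP: br => /eqP->; rewrite /= /partial ltnSn ?eqxx ?orbT.
rewrite -[k.+1]addn1 iotaD all_cat /= add0n andbT; apply/andP; split.
  apply/allP=> x xk; move/allP/(_ x xk): cnt_w.
  move: xk; rewrite mem_iota => /andP[_ xk].
  rewrite !count_cat /=; case/orP: br => /eqP->/=; lia.
by rewrite !count_cat (k_s _ p1) (k_s _ p2); case/orP: br => /eqP->/=; lia.
Qed.

(** The parity of the position of [k] reveals the move: odd for a valley, even for a peak. Undoing a
    valley keeps the placeholder left of [k] and deletes [k] and the right one. *)
Definition unstep w' := let i := index k w' in
  if odd i then take i w' ++ drop i.+2 w' else take i w' ++ N :: drop i.+1 w'.

Lemma unstepK w w' : word k w -> w' \in step k w -> unstep w' = w.
Proof.
move=> /and4P[odd_w alt_w part_w _] /stepP[s1 [s2 [r [Dw br ->]]]].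
rewrite {w}Dw in odd_w alt_w part_w *.
have ev: odd (size s1) = false.
  by apply: even_position alt_w => //; apply: partial_le part_w.
have k_s1: (k \in s1) = false.
  apply/negP=> ks1; move: part_w; rewrite all_cat => /andP[/allP/(_ k ks1)].
  rewrite /partial; lia.
have NkF: (N == k) = false by lia.
case/orP: br => /eqP->; rewrite /unstep index_cat k_s1 /= ?NkF eqxx ?addn0 ?addn1 /= ev /=.
  by rewrite take_size_cat // drop_cat ltnNge leqnSn /= subSnn /= drop0.
have -> : drop (size s1).+3 (s1 ++ [:: N, k, N & s2]) = s2.
  by rewrite (catA s1 [:: N; k; N]) drop_size_cat // size_cat addn3.
by rewrite -cat_rcons take_size_cat ?size_rcons // cat_rcons.
Qed.

(** As [k] is the largest placed value, its neighbours at a valley position must both be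
    placeholders, so the valley move can be undone. At a peak position, [k] can always be raised to
    [N]. *)
Lemma word_unstep w' :
  word k.+1 w' -> word k (unstep w') /\ w' \in step k (unstep w').
Proof.
case/and4P=> odd_w alt_w part_w cnt_w.
have cnt1 x : x < k.+1 -> count_mem x w' = 1.
  by move=> xk; apply/eqP/(allP cnt_w); rewrite mem_iota.
have kw : k \in w' by rewrite -has_pred1 has_count cnt1.
case/splitPr: {w'}kw odd_w alt_w part_w {cnt_w} cnt1 => s1 s2 odd_w alt_w part_w cnt1.
have [k_s1 k_s2]: k \notin s1 /\ k \notin s2.
  have := cnt1 k (ltnSn k); rewrite count_cat /= eqxx addnCA add1n => -[] /eqP.
  by rewrite addn_eq0 => /andP[/eqP c1 /eqP c2]; split; apply/count_memPn.
have down s : k \notin s -> all (partial N k.+1) s -> all (partial N k) s.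
  move=> ks ps; apply/allP=> x xs; have := allP ps x xs; rewrite /partial.
  have : x != k by apply: contraNneq ks => <-.
  lia.
have [p1 p2]: all (partial N k) s1 /\ all (partial N k) s2.
  by move: part_w; rewrite all_cat /= => /and3P[*]; rewrite !down.
have partN : partial N k N by rewrite /partial eqxx orbT.
rewrite /unstep index_cat (negPf k_s1) /= eqxx addn0.
case: ifPn => [odd1 | /negPf ev1].
- case/lastP: s1 odd_w alt_w part_w cnt1 k_s1 p1 odd1
    => [|s1 a] // odd_w alt_w part_w cnt1 k_s1 p1 odd1.
  have ev1: odd (size s1) = false by move: odd1; rewrite size_rcons /= => /negPf.
  (* A valley cannot be the last letter of a word of odd length. *)
  case: s2 odd_w alt_w part_w cnt1 k_s2 p2 => [|b s2] odd_w alt_w part_w cnt1 k_s2 p2.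
    by move: odd_w; rewrite size_cat size_rcons /= addn1 /= ev1.
  have [ka kb]: k < a /\ k < b.
    by rewrite cat_rcons in alt_w; apply: alternating_dip alt_w.
  have [Na Nb]: a = N /\ b = N.
    move: p1 p2; rewrite all_rcons /= /partial; lia.
  rewrite {a}Na {b}Nb in odd_w alt_w part_w cnt1 k_s1 k_s2 p1 p2 ka kb odd1 *.
  rewrite take_size_cat // size_rcons.
  have -> : drop (size s1).+3 (rcons s1 N ++ [:: k, N & s2]) = s2.
    by rewrite cat_rcons (catA s1 [:: N; k; N]) drop_size_cat // size_cat addn3.
  rewrite !cat_rcons in odd_w alt_w part_w cnt1 *; split; last first.
    by apply/stepP; exists s1, s2, [:: N; k; N]; rewrite /block eqxx orbT.
  rewrite alternating_valley // in alt_w.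
  apply/and4P; split=> //.
  + by move: odd_w; rewrite !size_cat /= !oddD /= negbK.
  + by move: p1 p2; rewrite all_rcons all_cat /= => /andP[_ ->] ->.
  apply/allP=> x; rewrite mem_iota => /andP[_ xk].
  have := cnt1 x (ltnW xk); rewrite !count_cat /=; lia.
rewrite take_size_cat // drop_cat ltnNge leqnSn /= subSnn /= drop0.
split; last by apply/stepP; exists s1, s2, [:: k]; rewrite /block eqxx.
apply/and4P; split.
- by move: odd_w; rewrite !size_cat.
- by apply: alternating_raise.
- by rewrite all_cat p1 /= partN.
apply/allP=> x; rewrite mem_iota => /andP[_ xk].
have := cnt1 x (ltnW xk); rewrite !count_cat /=; lia.
Qed.

(** The position of [k] determines the placeholder chosen, and the length of the result
    distinguishes the two moves. *)
Lemma uniq_step w : word k w -> uniq (step k w).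
Proof.
case/and4P=> _ _ part_w _.
have uocc : uniq (occ w) by rewrite filter_uniq ?iota_uniq.
have NkF : (N == k) = false by lia.
have kw i : (k \in take i w) = false.
  by apply/negP=> /mem_take /(allP part_w); rewrite /partial; lia.
have lt_occ i : i \in occ w -> i < size w.
  by rewrite mem_filter mem_iota => /andP[_].
have size_occ i : i \in occ w -> size (take i w) = i.
  by move=> /lt_occ lt_iw; rewrite size_take lt_iw.
have idx1 i : i \in occ w -> index k (rep [:: k] w i) = i.
  by move=> io; rewrite index_cat kw /= eqxx addn0 size_occ.
have idx2 i : i \in occ w -> index k (rep [:: N; k; N] w i) = i.+1.
  by move=> io; rewrite index_cat kw /= NkF eqxx addn1 size_occ.
rewrite cat_uniq !map_inj_in_uniq ?uocc ?andbT //=.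
- apply/hasPn=> _ /mapP[i io ->]; apply/mapP=> -[j jo /(congr1 size)].
  have := lt_occ i io; have := lt_occ j jo.
  by rewrite !size_cat !size_occ // !size_drop /=; lia.
- by move=> i j io jo /(congr1 (index k)); rewrite !idx2 // => -[].
- by move=> i j io jo /(congr1 (index k)); rewrite !idx1.
Qed.

End Step.

Lemma mem_words k w : k <= N -> (w \in words k) = word k w.
Proof.
elim: k w => [|k IH] w kN /=.
  rewrite inE /word; apply/eqP/idP=> [->|]; first by rewrite /= /partial eqxx.
  rewrite andbT /partial /=; case: w => [|a [|b w]] //=.
    by rewrite andbT => /eqP->.
  by case/and5P=> _ /andP[lt_ba _] /eqP Da /eqP Db _; rewrite Da Db ltnn in lt_ba.
apply/idP/idP => [/flattenP[s /mapP[w0 w0k ->]] | wk].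
  by apply: word_step; rewrite // -IH // ltnW.
have [w1 w2] := word_unstep kN wk.
by apply/flattenP; exists (step k (unstep k w)) => //; rewrite map_f ?IH // ltnW.
Qed.

(** Distinct words have disjoint sets of successors, because [unstep] recovers the predecessor. *)
Lemma uniq_words k : k <= N -> uniq (words k).
Proof.
elim: k => //= k IH kN.
have: {subset words k <= word k} by move=> w; rewrite mem_words // ltnW.
elim: (words k) (IH (ltnW kN)) => // w s IHs /andP[w_s us] sub.
rewrite [flatten _]/= cat_uniq (uniq_step kN) ?IHs ?andbT /=; last first.
- exact/sub/mem_head.
- by move=> x xs; apply: sub; rewrite inE xs orbT.
- exact: us.
apply/hasPn=> w' /flattenP[_ /mapP[w1 w1s ->]] w'1; apply/negP=> w'w.
case/negP: w_s; rewrite -(unstepK kN (sub _ (mem_head _ _)) w'w).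
by rewrite (unstepK kN _ w'1) //; apply: sub; rewrite inE w1s orbT.
Qed.

End Words.

(** * Weighted sums of words *)
Local Open Scope ring_scope.

Lemma eq_big_in (V : nmodType) (I : eqType) (r : seq I) (P1 P2 : pred I) (F1 F2 : I -> V) :
  {in r, P1 =1 P2} -> (forall i, i \in r -> P2 i -> F1 i = F2 i) ->
  \sum_(i <- r | P1 i) F1 i = \sum_(i <- r | P2 i) F2 i.
Proof.
move=> eqP eqF; rewrite big_seq_cond [RHS]big_seq_cond; apply: eq_big => i.
  by apply: andb_id2l => /eqP.
by case/andP=> ir; rewrite eqP // => /(eqF i ir).
Qed.

Section Weights.
Variables (R : comRingType) (p q : R) (N : nat).

Lemma pqintS n : pqint p q n.+1 = p ^+ n + q * pqint p q n.
Proof.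
rewrite /pqint big_ord_recr /= subnn mulr1 addrC mulr_sumr; congr (_ + _).
apply: eq_bigr => i _; rewrite mulrCA -exprS; congr (_ * _ ^+ _).
by have := ltn_ord i; lia.
Qed.

Definition insert_weight w i : R :=
  p ^+ count_mem N (drop i.+1 w) * q ^+ count_mem N (take i w).

(** A new first placeholder contributes a power of [p] alone and gives every later one a factor [q],
    as in [pqintS]. *)
Lemma sum_insert_weight w :
  \sum_(i <- occ N w) insert_weight w i = pqint p q (count_mem N w).
Proof.
elim: w => [|x w IH]; first by rewrite big_nil /pqint big_ord0.
rewrite occ_cons big_cat big_map /=.
under [X in _ + X]eq_bigr => i _.
  rewrite /insert_weight /= exprD mulrCA -/(insert_weight w i). over.
rewrite -mulr_sumr IH; case: (x == N) => /=; last first.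
  by rewrite big_nil add0r expr0 mul1r.
by rewrite big_seq1 /insert_weight /= drop0 mulr1 pqintS.
Qed.

(* [b] is true for the even series, whose words keep a final placeholder. *)
Definition weight (b : bool) w : R := p ^+ rstat b w [::] * q ^+ lstat [::] w.

Definition admissible (b : bool) H w :=
  (count_mem N w == H) && (b ==> (last 0%N w == N)).

Definition wsum b k H := \sum_(w <- words N k | admissible b H w) weight b w.

Section Step.
Variable k : nat.
Hypothesis kN : (k < N)%N.

Let NkF : (k == N) = false. Proof. by lia. Qed.


Let wordE s1 s2 : word N k (s1 ++ N :: s2) ->
  all (partial N k) (s1 ++ N :: s2) /\ sorted (noNN N) (s1 ++ N :: s2).
Proof. by case/and4P=> _ /alternating_noNN ns ps _. Qed.

Lemma sum_valley b H w : word N k w ->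
  \sum_(i <- occ N w | admissible b H (rep [:: N; k; N] w i))
      weight b (rep [:: N; k; N] w i)
    = if admissible b H.-1 w then pqint p q H.-1 * weight b w else 0.
Proof.
move=> wk.
have -> : \sum_(i <- occ N w | admissible b H (rep [:: N; k; N] w i))
      weight b (rep [:: N; k; N] w i) =
    \sum_(i <- occ N w | admissible b H.-1 w && (0 < H)%N)
      insert_weight w i * weight b w.
  apply: eq_big_in => i /occP[s1 [s2 [Dw ->]]]; rewrite {}Dw in wk *; rewrite rep_cat.
    rewrite /admissible !last_cat /= !count_cat /= eqxx NkF.
    by case: (b ==> _); rewrite ?andbF ?andbT //=; lia.
  case/andP=> /andP[_ lastN] _; have [ps ns] := wordE wk.
  rewrite /weight (lstat_insert kN ps ns (r := [:: N; k; N])) ?/block ?eqxx ?orbT // /insert_weight.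
  rewrite take_size_cat // drop_cat ltnNge leqnSn /= subSnn /= drop0.
  have -> : rstat b (s1 ++ [:: N, k, N & s2]) [::]
      = (rstat b (s1 ++ N :: s2) [::] + count_mem N s2)%N.
    case: b lastN => [|_]; last first.
      by rewrite -(rstat_asc_insert kN ps ns (r := [:: N; k; N])) // /block eqxx orbT.
    by rewrite last_cat => /eqP; apply: (rstat_desc_insert_valley kN ps ns).
  rewrite !exprD; ring.
(* For [H = 0] the truncated predecessor is harmless: a valley leaves placeholders, and [0] = 0. *)
case: H => [|H] /=; first by rewrite andbF big_pred0_eq /pqint big_ord0 mul0r if_same.
rewrite andbT; case: ifP => [/andP[/eqP<- _]|_]; last by rewrite big_pred0_eq.
by rewrite -big_distrl sum_insert_weight.
Qed.

Let weight_peak (b : bool) s1 s2 : word N k (s1 ++ N :: s2) ->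
  (b -> s2 != [::] /\ last N s2 = N) ->
  weight b (s1 ++ k :: s2)
    = p ^+ (count_mem N s2 - b) * q ^+ count_mem N s1 * weight b (s1 ++ N :: s2).
Proof.
move=> /wordE[ps ns] lastN; rewrite /weight -[k :: s2]cat1s.
rewrite (lstat_insert kN ps ns) ?/block ?eqxx //.
have -> : rstat b (s1 ++ [:: k] ++ s2) [::]
    = (rstat b (s1 ++ N :: s2) [::] + (count_mem N s2 - b))%N.
  case: b lastN => [[]//|_]; last first.
    by rewrite subn0 (rstat_asc_insert kN ps ns) // /block eqxx.
  by move=> s2n lastN; rewrite subn1 -(rstat_desc_insert_peak kN ps ns).
rewrite !exprD; ring.
Qed.

(** In the odd case all H+1 placeholders are available. In the even case the final one must stay and
    each exponent of [p] drops by one, which leaves the sum over the H others. *)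
Lemma sum_peak b H w : word N k w ->
  \sum_(i <- occ N w | admissible b H (rep [:: k] w i)) weight b (rep [:: k] w i)
    = if admissible b H.+1 w then pqint p q (H.+1 - b) * weight b w else 0.
Proof.
case: b => wk; last first.
  have -> : \sum_(i <- occ N w | admissible false H (rep [:: k] w i))
        weight false (rep [:: k] w i) =
      \sum_(i <- occ N w | admissible false H.+1 w)
        insert_weight w i * weight false w.
    apply: eq_big_in => i /occP[s1 [s2 [Dw ->]]]; rewrite {}Dw in wk *; rewrite rep_cat.
      by rewrite /admissible !count_cat /= !eqxx NkF; lia.
    rewrite weight_peak // subn0 /insert_weight take_size_cat //.
    by rewrite drop_cat ltnNge leqnSn /= subSnn /= drop0.
  rewrite subn0; case: ifP => [/andP[/eqP<- _]|_]; last by rewrite big_pred0_eq.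
  by rewrite -big_distrl sum_insert_weight.
case/lastP: w wk => [|w x] wk; first by case/andP: wk.
have -> : occ N (rcons w x) = occ N w ++ nseq (x == N) (size w).
  rewrite /occ size_rcons -addn1 iotaD filter_cat /= nth_rcons ltnn eqxx.
  congr (_ ++ _); last by case: (_ == _).
  by apply: eq_in_filter => i; rewrite mem_iota nth_rcons => /andP[_ ->].
(* Replacing the final placeholder would make [k] the last letter, which is not admissible. *)
rewrite big_cat /= [X in _ + X]big1_seq ?addr0; last first.
  move=> i /andP[/andP[_ /=]]; rewrite mem_nseq => + /andP[_ /eqP Di].
  by rewrite {i}Di /rep drop_oversize ?size_rcons // last_cat /= NkF.
have -> : \sum_(i <- occ N w | admissible true H (rep [:: k] (rcons w x) i))
      weight true (rep [:: k] (rcons w x) i) =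
    \sum_(i <- occ N w | admissible true H.+1 (rcons w x))
      insert_weight w i * weight true (rcons w x).
  apply: eq_big_in => i /occP[s1 [s2 [Dw ->]]]; rewrite {}Dw in wk *.
    rewrite rcons_cat rcons_cons rep_cat /admissible !last_cat /= !last_rcons.
    by rewrite !count_cat /= NkF eqxx; case: (x == N); rewrite ?andbF ?andbT //; lia.
  rewrite rcons_cat rcons_cons in wk *.
  rewrite rep_cat /admissible last_cat /= last_rcons => /andP[_ /eqP Dx].
  rewrite weight_peak //; last by rewrite last_rcons -size_eq0 size_rcons.
  rewrite /insert_weight take_size_cat // drop_cat ltnNge leqnSn /= subSnn /= drop0.
  by rewrite -cats1 count_cat /= Dx eqxx addn0 addnK.
case: ifP => [|_]; last by rewrite big_pred0_eq.
rewrite /admissible last_rcons => /andP[/eqP cntH /= /eqP Dx].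
rewrite -big_distrl sum_insert_weight; congr (pqint p q _ * _).
by move: cntH; rewrite -cats1 count_cat /= Dx eqxx; lia.
Qed.

End Step.

Lemma wsum0 b H : wsum b 0 H = (H == 1)%:R.
Proof.
rewrite /wsum /= big_mkcond big_seq1 /admissible /= eqxx implybT andbT eq_sym.
by case: eqP => // _; rewrite /weight /= mulr1.
Qed.

Lemma wsumS b k H : (k < N)%N ->
  wsum b k.+1 H = pqint p q (H.+1 - b) * wsum b k H.+1 + pqint p q H.-1 * wsum b k H.-1.
Proof.
move=> kN; rewrite /wsum /= big_flatten big_map /= (big_mkcond (admissible b H.+1))
  (big_mkcond (admissible b H.-1)).
rewrite !mulr_sumr -big_split /= big_seq [RHS]big_seq; apply: eq_bigr => w.
rewrite mem_words ?(ltnW kN) // => wk; rewrite big_cat !big_map /=.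
by rewrite sum_peak // sum_valley //; congr (_ + _); case: ifP; rewrite ?mulr0.
Qed.

(** The height is the number of placeholders minus one. A valley is an up-step arriving at h from h
    placeholders; a peak is a down-step arriving at h from h+2 placeholders. *)
Lemma wsum_wpath b k h : (k <= N)%N ->
  wsum b k h.+1 = wpath (pqint p q) (fun h => pqint p q (h.+2 - b)) k h.
Proof.
elim: k h => [|k IH] h kN; first by rewrite wsum0.
rewrite wsumS // IH 1?ltnW //=; congr (_ + _).
case: h => [|h] /=; first by rewrite /pqint big_ord0 !mul0r.
by rewrite IH // ltnW.
Qed.

End Weights.

(** * From words to permutations *)
Local Open Scope nat_scope.

Lemma adjE r s n : size s <= n ->
  adj r s = \sum_(i < n) ((i.+1 < size s) && r (nth 0 s i) (nth 0 s i.+1)).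
Proof.
elim: s n => [|a s IH] [|n] //= sn; try by rewrite ?big_ord0 ?big1.
rewrite big_ord_recl (IH n) //=; congr (_ + _).
by case: s {IH sn}.
Qed.

Lemma adj_takeE r s j : j <= size s ->
  adj r (take j s) = \sum_(i < size s) ((i.+1 < j) && r (nth 0 s i) (nth 0 s i.+1)).
Proof.
move=> js; rewrite (@adjE r _ (size s)) size_takel //; apply: eq_bigr => i _.
by case: ltnP => //= ij; rewrite !nth_take // ltnW.
Qed.

Lemma adj_dropE r s j : adj r (drop j s)
  = \sum_(i < size s) [&& j <= i, i.+1 < size s & r (nth 0 s i) (nth 0 s i.+1)].
Proof.
elim: s j => [|a s IH] j; first by rewrite big_ord0.
case: j => [|j]; first by rewrite drop0 (@adjE r _ (size s).+1).
by rewrite /= big_ord_recl /= IH.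
Qed.

Lemma lstatE u s :
  lstat u s = \sum_(j < size s) adj (straddle true (nth 0 s j)) (u ++ take j s).
Proof.
elim: s u => [|a s IH] u; first by rewrite big_ord0.
rewrite /= big_ord_recl /= cats0 IH; congr (_ + _).
by apply: eq_bigr => j _; rewrite cat_rcons.
Qed.

Lemma rstatE d s :
  rstat d s [::] = \sum_(j < size s) adj (straddle d (nth 0 s j)) (drop j.+1 s).
Proof. by elim: s => [|a s IH]; rewrite ?big_ord0 //= big_ord_recl /= drop0 cats0 IH. Qed.

Lemma alternatingP b s :
  reflect (forall i, i.+1 < size s ->
            if b (+) odd i then nth 0 s i < nth 0 s i.+1 else nth 0 s i.+1 < nth 0 s i)
          (alternating b s).
Proof.
elim: s b => [|a s IH] b /=; first by left.
apply: (iffP andP) => [[a_s /IH alt_s] [|i]|alt_s].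
- by case: s a_s {IH alt_s} => //= c s; rewrite addbF.
- by move/alt_s; rewrite /= addbN addNb.
split; first by case: s alt_s {IH} => //= c s /(_ 0 isT); rewrite addbF.
by apply/IH => i /(alt_s i.+1); rewrite /= addbN addNb.
Qed.

Lemma alternating_rcons b s x : all (gtn x) s -> b (+) odd (size s) = false ->
  alternating b (rcons s x) = alternating b s.
Proof.
elim: s b => [|a s IH] b //= /andP[ax xs] odd_s; rewrite IH //; last first.
  by move: odd_s; case: b; case: (odd _).
case: s odd_s {IH xs} => //=; rewrite addbT => /negbFE->.
by rewrite ax.
Qed.

(** A final maximum is neither the bottom of a straddled descent nor straddled itself. *)
Lemma stat_rcons_max s x : all (geq x) s ->
  lstat [::] (rcons s x) = lstat [::] s /\ rstat true (rcons s x) [::] = rstat true s [::].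
Proof.
move=> xs; rewrite -cats1 lstat_cat rstat_cat /= adj_straddle_max // !addn0; split=> //.
elim: s xs => //= a s IH /andP[ax xs].
by rewrite IH // cats1 cats0 adj_desc_rcons.
Qed.

Section Permutations.
Variable m : nat.

Lemma size_pword (s : 'S_m) : size (pword s) = m.
Proof. by rewrite size_map size_enum_ord. Qed.

Lemma pword_perm_eq (s : 'S_m) : perm_eq (pword s) (iota 0 m).
Proof.
rewrite -val_enum_ord /pword (map_comp val s) perm_map // uniq_perm ?enum_uniq //.
  by rewrite map_inj_uniq ?enum_uniq //; apply: perm_inj.
by move=> i; rewrite mem_enum -[i](permKV s) mem_map ?mem_enum //; apply: perm_inj.
Qed.

Lemma pword_inj : injective (@pword m).
Proof.
move=> s t /eq_in_map st; apply/permP=> i.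
by apply/val_inj/st; rewrite mem_enum.
Qed.

Lemma pwordP w : perm_eq w (iota 0 m) -> exists s : 'S_m, pword s = w.
Proof.
move=> pw; have size_w : size w = m by rewrite (perm_size pw) size_iota.
have lt_w (i : 'I_m) : nth 0 w i < m.
  have iw : i < size w by rewrite size_w.
  by have := mem_nth 0 iw; rewrite (perm_mem pw) mem_iota => /andP[].
have w_inj : injective (fun i : 'I_m => Ordinal (lt_w i)).
  move=> i j [] /eqP; rewrite nth_uniq ?size_w ?(perm_uniq pw) ?iota_uniq //.
  by move=> /eqP/val_inj.
exists (perm w_inj); rewrite /pword.
under eq_map => i do rewrite permE /=.
by rewrite (map_comp (nth 0 w) val) val_enum_ord -size_w map_nth_iota0 // take_size.
Qed.

Lemma faltE (s : 'S_m) : falt s = alternating false (pword s).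
Proof.
apply/forallP/alternatingP => [alt_s i | alt_s i].
  rewrite size_pword => im; have /= := alt_s (Ordinal (ltnW im)).
  by rewrite im.
by apply/implyP=> im; have := alt_s i; rewrite size_pword; apply.
Qed.

Lemma st31_2E (s : 'S_m) : st31_2 s = lstat [::] (pword s).
Proof.
rewrite lstatE size_pword /st31_2 exchange_big; apply: eq_bigr => j _.
rewrite cat0s adj_takeE ?size_pword 1?ltnW //; apply: eq_bigr => i _.
by rewrite /straddle [(_ < pw s i) && _]andbC.
Qed.

Lemma st2_31E (s : 'S_m) : st2_31 s = rstat true (pword s) [::].
Proof.
rewrite rstatE size_pword /st2_31 exchange_big; apply: eq_bigr => j _.
rewrite adj_dropE size_pword; apply: eq_bigr => i _.
by rewrite /straddle [(_ < pw s i) && _]andbC.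
Qed.

Lemma st2_13E (s : 'S_m) : st2_13 s = rstat false (pword s) [::].
Proof.
rewrite rstatE size_pword /st2_13 exchange_big; apply: eq_bigr => j _.
by rewrite adj_dropE size_pword; apply: eq_bigr => i _.
Qed.

(* In the even case a final placeholder makes the length odd. *)
Let pad (b : bool) (s : 'S_m) := pword s ++ nseq b m.

Let pword_lt s : all (gtn m) (@pword m s).
Proof.
by rewrite (perm_all _ (pword_perm_eq s)); apply/allP=> x; rewrite mem_iota => /andP[].
Qed.

Let count_pword s x : count_mem x (@pword m s) = (x < m).
Proof.
by rewrite (seq.permP (pword_perm_eq s)) count_uniq_mem ?iota_uniq // mem_iota.
Qed.

Let alternating_pad (b : bool) s : odd m = ~~ b ->
  alternating false (pad b s) = falt s.
Proof.
rewrite /pad faltE; case: b => odd_m; last by rewrite cats0.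
by rewrite cats1 alternating_rcons // size_pword odd_m.
Qed.

Let word_pad (b : bool) s : odd m = ~~ b ->
  word m m (pad b s) = falt s.
Proof.
move=> odd_m; rewrite /word alternating_pad //.
have -> : odd (size (pad b s)).
  by rewrite size_cat size_pword size_nseq oddD odd_m; case: (b).
have -> : all (partial m m) (pad b s).
  rewrite all_cat all_nseq /partial eqxx !orbT andbT.
  by apply: sub_all (pword_lt s) => x /= ->.
rewrite (_ : all _ _) ?andbT //; apply/allP=> x; rewrite mem_iota => /andP[_ xm].
by rewrite count_cat count_pword count_nseq /= xm (gtn_eqF xm).
Qed.

Let admissible_pad b s : admissible m b b (pad b s).
Proof.
rewrite /admissible count_cat count_pword ltnn count_nseq /= eqxx mul1n eqxx.
by case: b; rewrite // last_cat /= eqxx.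
Qed.

Let word_is_pad b w : word m m w -> admissible m b b w -> exists s, w = pad b s.
Proof.
case/and4P=> odd_w _ pw cw /andP[/eqP cnt_m last_w].
have [w0 Dw]: exists w0, w = w0 ++ nseq b m.
  case: b last_w {cnt_m} => /= [|_]; last by exists w; rewrite cats0.
  case/lastP: w odd_w {pw cw} => [|w x] // _.
  by rewrite last_rcons => /eqP->; exists w; rewrite cats1.
rewrite {w odd_w last_w}Dw in pw cw cnt_m *.
have m_w0 : m \notin w0.
  by apply/count_memPn; move: cnt_m; rewrite count_cat count_nseq /= eqxx; lia.
have w0_lt x : x \in w0 -> x < m.
  move=> xw; have /allP/(_ x) := pw; rewrite mem_cat xw => /(_ isT).
  by case/orP=> // /eqP xm; rewrite -xm xw in m_w0.
have [s Dw0] : exists s : 'S_m, pword s = w0; last by exists s; rewrite /pad Dw0.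
apply: pwordP; apply/allP=> x; rewrite mem_cat mem_iota => xw.
have xm : x < m by case/orP: xw => [/w0_lt|/andP[]].
rewrite /= [count_mem x (iota 0 m)]count_uniq_mem ?iota_uniq // mem_iota xm /=.
have /allP/(_ x) := cw; rewrite mem_iota xm count_cat count_nseq /= (gtn_eqF xm).
by rewrite mul0n addn0; apply.
Qed.

(** With [N = m] and all [m] values placed, a word has no placeholder left in the odd case and only
    the final one in the even case. Deleting it gives the permutation. *)
Lemma words_perm (b : bool) : odd m = ~~ b ->
  perm_eq [seq pad b s | s <- enum 'S_m & falt s]
          [seq w <- words m m | admissible m b b w].
Proof.
move=> odd_m; apply: uniq_perm.
- rewrite map_inj_uniq; first exact/filter_uniq/enum_uniq.
  by move=> s t /eqP; rewrite eqseq_cat ?size_pword // => /andP[/eqP/pword_inj].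
- by rewrite filter_uniq ?uniq_words.
move=> w; rewrite mem_filter mem_words //.
apply/mapP/andP=> [[s + ->] | [adm_w word_w]].
  by rewrite mem_filter admissible_pad word_pad // => /andP[].
have [s Dw] := word_is_pad word_w adm_w.
by exists s; rewrite // mem_filter mem_enum andbT -(word_pad s odd_m) -Dw.
Qed.

Lemma weight_pad (R : comRingType) (p q : R) b s :
  weight p q b (pad b s)
    = (p ^+ (if b then st2_31 s else st2_13 s) * q ^+ st31_2 s)%R.
Proof.
rewrite /weight st31_2E st2_31E st2_13E /pad; case: b; last by rewrite cats0.
have := @stat_rcons_max (pword s) m; rewrite cats1 => -[|-> ->] //.
by apply: sub_all (pword_lt s) => x /ltnW.
Qed.

Lemma sum_falt (R : comRingType) (p q : R) (b : bool) : odd m = ~~ b ->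
  (\sum_(s : 'S_m | falt s)
     p ^+ (if b then st2_31 s else st2_13 s) * q ^+ st31_2 s = wsum p q m b m b)%R.
Proof.
move=> odd_m; rewrite /wsum -[RHS]big_filter -(perm_big _ (words_perm odd_m)).
rewrite big_map big_filter big_enum_cond /=.
by apply: eq_bigr => s _; rewrite weight_pad.
Qed.

End Permutations.

Local Open Scope ring_scope.

(** * The two series as path counts *)

Lemma pqint0 (R : comRingType) (p q : R) : pqint p q 0 = 0.
Proof. by rewrite /pqint big_ord0. Qed.

Lemma Eodd_wpath (R : comRingType) (p q : R) n :
  Eodd p q n = wpath (pqint p q) (fun h => pqint p q h.+2) n.*2 0.
Proof.
rewrite /Eodd (@sum_falt _ R p q false) /= ?odd_double //.
(* A finished odd word has no placeholder, which would be height -1. Its last move, a peak of weight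
   [1] = 1, is split off, leaving a path of length 2n back to height 0. *)
rewrite wsumS // wsum_wpath //= subn0 pqintS pqint0 mul0r mulr0 !addr0 mul1r.
by [].
Qed.

Lemma Eeven_wpath (R : comRingType) (p q : R) n :
  Eeven p q n = wpath (pqint p q) (fun h => pqint p q h.+1) n.*2 0.
Proof.
by rewrite /Eeven (@sum_falt _ R p q true) /= ?odd_double // wsum_wpath.
Qed.

Theorem theorem2p1 (R : comRingType) (p q : R) :
  (forall k : nat, exists M : nat, forall m : nat, (M <= m)%N ->
     (* odd series: t * cfrac with a_i = [i+1][i+2] *)
     (if odd k then Eodd p q k./2 else 0)
       = (if k is k'.+1
          then cfrac (fun i => pqint p q i.+1 * pqint p q i.+2) m k'
          else 0))
  /\
  (forall k : nat, exists M : nat, forall m : nat, (M <= m)%N ->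
     (* even series: cfrac with a_i = [i+1]^2 *)
     (if odd k then 0 else Eeven p q k./2)
       = cfrac (fun i => pqint p q i.+1 ^+ 2) m k).
Proof.
have pq0 := pqint0 p q.
(* Depth m is already exact up to degree m, so [M = k] works. Coefficients of the wrong parity
   vanish by [wpath_parity]. *)
split=> k; exists k => m le_km.
  case: k le_km => [|k] //= lt_km.
  rewrite (@cfrac_wpath R (pqint p q) (fun h => pqint p q h.+2) pq0) 1?ltnW // Eodd_wpath.
  case: ifPn => [ev_k | /negbNE odd_k].
    by rewrite uphalf_half (negPf ev_k) even_halfK.
  by rewrite wpath_parity ?addn0.
have -> : cfrac (fun i => pqint p q i.+1 ^+ 2) m k
    = cfrac (fun i => pqint p q i.+1 * pqint p q i.+1) m k by [].
rewrite (@cfrac_wpath R (pqint p q) (fun h => pqint p q h.+1) pq0) // Eeven_wpath.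
case: ifPn => [odd_k | /even_halfK->//].
by rewrite wpath_parity ?addn0.
Qed.
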